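(* Let $1\le k<n$ and $m_E\ge1$ be integers and let $P_M,P_R,\gamma,\sigma>0$. Let $Q_K=[Q_1\mid Q_2]\in\mathbb{R}^{n\times n}$ be an orthogonal matrix with $Q_1\in\mathbb{R}^{n\times k}$, $Q_2\in\mathbb{R}^{n\times(n-k)}$, and let $H_E\in\mathbb{R}^{m_E\times n}$. Let $M\sim\mathcal{N}(0,P_MI_k)$, $R\sim\mathcal{N}(0,P_RI_{n-k})$ and $N_E\sim\mathcal{N}(0,\sigma^2I_{m_E})$ be independent. Put $S=\frac{1}{\sqrt\gamma}\begin{bmatrix}M\\R\end{bmatrix}$, $X=Q_KS$ and $Y_E=H_EX+N_E$. Then $$h(M\mid Y_E)\ge h(M)-\frac12\log\det\left(I_k+\frac{P_M}{\gamma}H_{\rm eff}^T\Sigma_{RN}^{-1}H_{\rm eff}\right),$$ where $H_{\rm eff}=H_EQ_1$ and $\Sigma_{RN}=\sigma^2I_{m_E}+\frac{P_R}{\gamma}H_EQ_2Q_2^TH_E^T$.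
   Context: $h(\cdot)$ and $h(\cdot\mid\cdot)$ denote differential entropy and conditional differential entropy, in the base of $\log$. *)

(* Defs.v *)
From HB Require Import structures.
From mathcomp Require Import all_boot all_order all_algebra.
From mathcomp Require Import all_classical all_reals all_analysis.

Set Implicit Arguments.
Unset Strict Implicit.
Unset Printing Implicit Defensive.

Import Order.TTheory GRing.Theory Num.Theory.
Import numFieldNormedType.Exports.

Local Open Scope classical_set_scope.
Local Open Scope ring_scope.

Definition measure_matrix_display : measure_display -> measure_display.
Proof. exact. Qed.

(* m1 \x m2 under a new name: on product_measure1, the sigma-finite instance of
   the library is shadowed by the one restricted to subprobabilities. *)
Section sigma_finite_product.
Context d1 d2 (T1 : measurableType d1) (T2 : measurableType d2) (R : realType).
Variables (m1 : {sigma_finite_measure set T1 -> \bar R})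
          (m2 : {sigma_finite_measure set T2 -> \bar R}).

Definition sfprod_measure : set (T1 * T2) -> \bar R := (m1 \x m2)%E.

HB.instance Definition _ := Measure.on sfprod_measure.

Let sigma_finite_sfprod : sigma_finite setT sfprod_measure.
Proof.
have /sigma_finiteP[F [TF ndF Foo]] := sigma_finiteT m1.
have /sigma_finiteP[G [TG ndG Goo]] := sigma_finiteT m2.
exists (fun n => F n `*` G n).
  rewrite -setXTT TF TG predeqE => -[x y]; split.
    move=> [/= [n _ Fnx] [k _ Gky]]; exists (maxn n k) => //; split.
    - by move: x Fnx; exact/subsetPset/ndF/leq_maxl.
    - by move: y Gky; exact/subsetPset/ndG/leq_maxr.
  by move=> [n _ []/= ? ?]; split; exists n.
move=> k; have [? ?] := Foo k; have [? ?] := Goo k.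
split; first exact: measurableX.
by rewrite /sfprod_measure product_measure1E// lte_mul_pinfty// ge0_fin_numE.
Qed.

HB.instance Definition _ :=
  Measure_isSigmaFinite.Build _ _ _ sfprod_measure sigma_finite_sfprod.

End sigma_finite_product.

(* The product sigma-algebra of the entries: the Borel sets when T is R. *)
Section matrix_measurable.
Context d (T : measurableType d) (m n : nat).

Definition matrix_cylinders : set (set 'M[T]_(m, n)) :=
  [set C | exists i j (B : set T),
     measurable B /\ C = (fun A : 'M[T]_(m, n) => A i j) @^-1` B].

Definition matrix_measurable : set (set 'M[T]_(m, n)) :=
  <<s matrix_cylinders >>.

Let matrix_measurable0 : matrix_measurable set0.
Proof. exact: sigma_algebra0. Qed.

Let matrix_measurableC A : matrix_measurable A -> matrix_measurable (~` A).
Proof. exact: sigma_algebraC. Qed.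

Let matrix_measurable_bigcup (F : (set 'M[T]_(m, n))^nat) :
  (forall i, matrix_measurable (F i)) -> matrix_measurable (\bigcup_i F i).
Proof. exact: sigma_algebra_bigcup. Qed.

HB.instance Definition _ := @isMeasurable.Build (measure_matrix_display d)
  'M[T]_(m, n) matrix_measurable matrix_measurable0 matrix_measurableC
  matrix_measurable_bigcup.

End matrix_measurable.

Lemma measurable_mx_entry d (T : measurableType d) m n (i : 'I_m) (j : 'I_n) :
  measurable_fun setT (fun A : 'M[T]_(m, n) => A i j).
Proof.
by move=> _ B mB; rewrite setTI; apply: sub_sigma_algebra; exists i, j, B.
Qed.

Lemma measurable_fun_mxP d d' (S : measurableType d) (T : measurableType d')
    m n (f : S -> 'M[T]_(m, n)) :
  measurable_fun setT f <->
  forall i j, measurable_fun setT (fun x => f x i j).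
Proof.
split=> [mf i j|mf].
  exact: (measurableT_comp (measurable_mx_entry i j) mf).
apply: (@measurability _ _ _ _ _ _ (@matrix_cylinders _ T m n)) => //.
by move=> _ [_ [i [j [B [mB ->]]]] <-]; exact: mf.
Qed.

Section lebesgue_measure_cons.
Context (R : realType) (n : nat).
Variable mu : {sigma_finite_measure set 'cV[R]_n -> \bar R}.

(* The Lebesgue measure of the library lives on measurableTypeR R, a copy of R
   with the same measurable sets. *)
Definition cV_cons (p : measurableTypeR R * 'cV[R]_n) : 'cV[R]_n.+1 :=
  col_mx ((p.1 : R)%:M : 'cV_1) p.2.

Definition cV_uncons (x : 'cV[R]_n.+1) : measurableTypeR R * 'cV[R]_n :=
  (x ord0 ord0, dsubmx (x : 'cV_(1 + n))).

Lemma cV_consK : cancel cV_cons cV_uncons.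
Proof.
move=> [a x]; rewrite /cV_cons /cV_uncons /= col_mxKd; congr pair.
have -> : ord0 = lshift n ord0 :> 'I_(1 + n) by exact: val_inj.
by rewrite (col_mxEu (a%:M : 'cV_1) x) mxE.
Qed.

Lemma cV_unconsK : cancel cV_uncons cV_cons.
Proof.
move=> x; rewrite /cV_cons /cV_uncons /= -[RHS](@vsubmxK _ 1 n 1).
congr (@col_mx _ 1 n 1 _ _); apply/matrixP => i j.
by rewrite !ord1 !mxE eqxx mulr1n; congr (x _ _); exact: val_inj.
Qed.

Lemma measurable_cV_cons : measurable_fun setT cV_cons.
Proof.
apply/measurable_fun_mxP => i j; rewrite ord1.
have [k ->|k ->] := @split_ordP 1 n i.
- rewrite (_ : (fun _ => _) = fst); first exact: (@measurable_fst _ _ (measurableTypeR R)).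
  by apply/funext => p; rewrite /cV_cons (@col_mxEu _ 1) mxE !ord1 eqxx.
- rewrite (_ : (fun _ => _) = (fun x : 'cV[R]_n => x k 0) \o snd).
    by apply: measurableT_comp; [exact: measurable_mx_entry|
                                 exact: measurable_snd].
  by apply/funext => p; rewrite /cV_cons (@col_mxEd _ 1).
Qed.

HB.instance Definition _ :=
  isMeasurableFun.Build _ _ _ _ cV_cons measurable_cV_cons.

Lemma measurable_cV_uncons : measurable_fun setT cV_uncons.
Proof.
apply/measurable_fun_pairP; split; first exact: measurable_mx_entry.
apply/measurable_fun_mxP => i j.
rewrite (_ : (fun _ => _) = fun x : 'cV[R]_n.+1 => x (rshift 1 i) j).
  exact: measurable_mx_entry.
by apply/funext => x; rewrite /= mxE.
Qed.

Definition lebesgue_cons : set 'cV[R]_n.+1 -> \bar R :=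
  pushforward (sfprod_measure (@lebesgue_measure R) mu) cV_cons.

Let lebesgue_cons0 : lebesgue_cons set0 = 0%E.
Proof. exact: measure0. Qed.

Let lebesgue_cons_ge0 A : (0 <= lebesgue_cons A)%E.
Proof. exact: measure_ge0. Qed.

Let lebesgue_cons_sigma_additive : semi_sigma_additive lebesgue_cons.
Proof.
exact: (@measure_semi_sigma_additive _ _ _
  (pushforward (sfprod_measure (@lebesgue_measure R) mu) cV_cons)).
Qed.

HB.instance Definition _ := isMeasure.Build _ _ _ lebesgue_cons
  lebesgue_cons0 lebesgue_cons_ge0 lebesgue_cons_sigma_additive.

Let sigma_finite_lebesgue_cons : sigma_finite setT lebesgue_cons.
Proof.
have [F UF mF] : sigma_finite setT (sfprod_measure (@lebesgue_measure R) mu).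
  exact: sigma_finiteT.
exists (fun i => cV_uncons @^-1` F i).
  by rewrite -preimage_bigcup -UF preimage_setT.
move=> i; have [mFi Fioo] := mF i; split.
  by rewrite -[X in measurable X]setTI; exact: measurable_cV_uncons.
rewrite /lebesgue_cons /pushforward -comp_preimage.
by rewrite (_ : cV_uncons \o cV_cons = id)//; apply/funext => p; exact: cV_consK.
Qed.

HB.instance Definition _ :=
  Measure_isSigmaFinite.Build _ _ _ lebesgue_cons sigma_finite_lebesgue_cons.

End lebesgue_measure_cons.

(* Lebesgue measure on R^n, by iterating the binary product measure. *)
Fixpoint lebesgue_cV (R : realType) (n : nat) :
    {sigma_finite_measure set 'cV[R]_n -> \bar R} :=
  match n with
  | 0 => \d_ (0 : 'cV[R]_0)
  | n'.+1 => lebesgue_cons (lebesgue_cV R n')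
  end.

Section random_vectors.
Context d (T : measurableType d) (R : realType) (P : probability T R).

Definition mutually_independent3 d1 d2 d3 (V1 : measurableType d1)
    (V2 : measurableType d2) (V3 : measurableType d3)
    (X1 : {RV P >-> V1}) (X2 : {RV P >-> V2}) (X3 : {RV P >-> V3}) : Prop :=
  forall A1 A2 A3, measurable A1 -> measurable A2 -> measurable A3 ->
    P (X1 @^-1` A1 `&` X2 @^-1` A2 `&` X3 @^-1` A3) =
    (P (X1 @^-1` A1) * P (X2 @^-1` A2) * P (X3 @^-1` A3))%E.

Definition mvnormal_pdf n (mu : 'cV[R]_n) (Sigma : 'M[R]_n) (x : 'cV[R]_n) : R :=
  (Num.sqrt ((2 * pi) ^+ n * \det Sigma))^-1 *
  expR (- (((x - mu)^T *m invmx Sigma *m (x - mu)) ord0 ord0 / 2)).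

(* X ~ N(mu, Sigma), for a positive definite covariance matrix Sigma. *)
Definition mvnormal n (X : {RV P >-> 'cV[R]_n}) (mu : 'cV[R]_n)
    (Sigma : 'M[R]_n) : Prop :=
  forall A, measurable A ->
    distribution P X A =
    (\int[lebesgue_cV R n]_(x in A) (mvnormal_pdf mu Sigma x)%:E)%E.

Section pair.
Context d1 d2 (V1 : measurableType d1) (V2 : measurableType d2).
Variables (X1 : {RV P >-> V1}) (X2 : {RV P >-> V2}).

Definition RV_pair (t : T) : V1 * V2 := (X1 t, X2 t).

Let measurable_RV_pair : measurable_fun setT RV_pair.
Proof. exact: measurable_fun_pair. Qed.

HB.instance Definition _ :=
  isMeasurableFun.Build _ _ _ _ RV_pair measurable_RV_pair.
End pair.

(* The density of X with respect to mu. It is determined mu-almost everywhere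
   when the law of X is absolutely continuous; otherwise this is the constant
   0, and the entropies below are meaningless. *)
Definition density d' (V : measurableType d')
    (mu : {sigma_finite_measure set V -> \bar R}) (X : {RV P >-> V}) (x : V) : R :=
  fine (Radon_Nikodym (charge_of_finite_measure (distribution P X)) mu x).

Definition logb (b x : R) : R := ln x / ln b.

(* h(X) = - \int f log f. Since ln 0 = 0 in the library, points where f = 0
   do not contribute. *)
Definition diff_entropy (b : R) n (X : {RV P >-> 'cV[R]_n}) : \bar R :=
  let f := density (lebesgue_cV R n) X in
  (- \int[lebesgue_cV R n]_x (f x * logb b (f x))%:E)%E.

(* h(X | Y) = - \int\int f(x, y) log f(x | y) dx dy, where f is the joint
   density and f(x | y) = f(x, y) / f_Y(y). *)
Definition cond_diff_entropy (b : R) n m (X : {RV P >-> 'cV[R]_n})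
    (Y : {RV P >-> 'cV[R]_m}) : \bar R :=
  let lambda := sfprod_measure (lebesgue_cV R n) (lebesgue_cV R m) in
  let f := density lambda (RV_pair X Y) in
  let fY := density (lebesgue_cV R m) Y in
  (- \int[lambda]_z (f z * logb b (f z / fY z.2))%:E)%E.

End random_vectors.

(* Stated with both products since k + (n - k) and n are not convertible. *)
Definition orthogonal_mx (R : realType) m n (Q : 'M[R]_(m, n)) : Prop :=
  Q *m Q^T = 1%:M /\ Q^T *m Q = 1%:M.

(* Main.v *)
(* All the laws involved are Gaussian, and equality in fact holds. Write
   YE = A M + Z with A = HE Q1 / sqrt gamma and Z = HE Q2 R / sqrt gamma + NE,
   which is independent of M. By Fubini and translation invariance, (M, YE) has
   density f_M(m) f_Z(y - A m); completing the square in a Gaussian integral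
   identifies f_Z and f_YE as the centered Gaussian densities of covariances
   SigmaRN and SigmaRN + PM A A^T. The logarithms of these densities are
   quadratic, so the entropies only involve the moments
   E[x^T Sigma^-1 x] = dim x, and h(M) - h(M | YE) is half the logarithm of the
   quotient of the two determinants. *)
Require Import Defs.
From HB Require Import structures.
From mathcomp Require Import all_boot all_order all_algebra.
From mathcomp Require Import all_classical all_reals all_analysis.
From mathcomp Require Import measurable_realfun.
From mathcomp Require Import ring lra.

Set Implicit Arguments.
Unset Strict Implicit.
Unset Printing Implicit Defensive.

Import Order.TTheory GRing.Theory Num.Theory.
Import numFieldNormedType.Exports.
Local Open Scope classical_set_scope.
Local Open Scope ring_scope.

(** * Positive definite matrices *)

Section quadratic_forms.
Variable R : rcfType.

(** [lebesgue_cV] is an iterated product measure, and this shapes the calculus: no general linear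
    change of variables is made. Gaussian integrals go by induction on the dimension, the first
    coordinate being integrated out; the Schur complement is what remains of the quadratic form, and
    the determinant is the product of the pivots met on the way. The only substitution in several
    variables is a shear, for which translation invariance suffices. Moments come from scaling:
    replacing [L] by [L / u^2] multiplies the Gaussian integral by [u^n], and the derivative [n] at
    [u = 1] is extracted by a squeeze instead of differentiating under the integral. [density] is a
    Radon-Nikodym derivative, pinned down only almost everywhere; explicit representatives are
    carried along and exchanged for it under the integral sign. In [h(M | YE)] the logarithm of
    [f_M f_Z / f_YE] has three quadratic terms; those of [Z] and [YE] have the same mean [mE] and
    opposite signs, so only the dimension of [M] survives. *)

Definition quad n (A : 'M[R]_n) (x : 'cV[R]_n) : R := (x^T *m A *m x) 0 0.

Definition posdef n (A : 'M[R]_n) : Prop :=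
  A^T = A /\ forall x, x != 0 -> 0 < quad A x.

Lemma trmx11 (x : 'M[R]_1) : x^T = x.
Proof. by apply/matrixP => i j; rewrite !ord1 mxE. Qed.

Lemma quad0 n (A : 'M[R]_n) : quad A 0 = 0.
Proof. by rewrite /quad mulmx0 mxE. Qed.

Lemma quad_scalar n (a : R) (x : 'cV[R]_n) :
  quad a%:M x = a * \sum_i x i 0 ^+ 2.
Proof.
rewrite /quad mul_mx_scalar -scalemxAl !mxE; congr (_ * _).
by apply: eq_bigr => i _; rewrite !mxE expr2.
Qed.

Lemma quad_scale n (A : 'M[R]_n) (a : R) (x : 'cV[R]_n) :
  quad (a *: A) x = a * quad A x.
Proof. by rewrite /quad -scalemxAr -scalemxAl mxE. Qed.

Lemma quad_ge0 n (A : 'M[R]_n) x : posdef A -> 0 <= quad A x.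
Proof.
move=> [_ A0]; have [->|/A0/ltW//] := eqVneq x 0.
by rewrite quad0.
Qed.

Lemma quad_congr m n (A : 'M[R]_n) (B : 'M[R]_(n, m)) x :
  quad A (B *m x) = quad (B^T *m A *m B) x.
Proof. by rewrite /quad trmx_mul !mulmxA. Qed.

Lemma quadD n (A B : 'M[R]_n) x : quad (A + B) x = quad A x + quad B x.
Proof. by rewrite /quad mulmxDr mulmxDl mxE. Qed.

Lemma posdef_scalar n (a : R) : 0 < a -> posdef (a%:M : 'M[R]_n).
Proof.
move=> a0; split; first by rewrite tr_scalar_mx.
move=> x x0; rewrite quad_scalar mulr_gt0//.
rewrite lt_neqAle sumr_ge0 ?andbT; last by move=> i _; exact: sqr_ge0.
apply: contra x0; rewrite eq_sym psumr_eq0; last by move=> i _; exact: sqr_ge0.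
move=> /allP x0; apply/eqP/matrixP => i j; rewrite !ord1 mxE.
by have := x0 i (mem_index_enum _); rewrite /= sqrf_eq0 => /eqP.
Qed.

Lemma posdef_scale n (A : 'M[R]_n) a : 0 < a -> posdef A -> posdef (a *: A).
Proof.
move=> a0 [tA A0]; split=> [|x x0]; first by rewrite linearZ/= tA.
by rewrite quad_scale mulr_gt0// A0.
Qed.

Lemma posdef_unit n (A : 'M[R]_n) : posdef A -> A \in unitmx.
Proof.
move=> [_ A0]; rewrite unitmxE unitfE; apply/negP => /det0P[v v0 vA].
have v0' : v^T != 0.
  by apply: contra v0 => /eqP/(congr1 trmx); rewrite trmxK trmx0 => /eqP.
by have := A0 _ v0'; rewrite /quad trmxK vA mul0mx mxE ltxx.
Qed.

Lemma posdef_tr_inv n (A : 'M[R]_n) : posdef A -> (invmx A)^T = invmx A.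
Proof. by move=> [tA _]; rewrite trmx_inv tA. Qed.

Lemma posdef_inv n (A : 'M[R]_n) : posdef A -> posdef (invmx A).
Proof.
move=> Apd; split; first exact: posdef_tr_inv.
move=> x x0; have uA := posdef_unit Apd.
have -> : quad (invmx A) x = quad A (invmx A *m x).
  by rewrite quad_congr posdef_tr_inv// mulVmx// mul1mx.
apply: Apd.2; apply: contra x0 => /eqP/(congr1 (mulmx A)).
by rewrite mulKVmx// mulmx0 => ->.
Qed.

(** This is the covariance of [W + B U] for independent [U], [W] of covariances [C], [A]. As [B] is
    arbitrary, the second summand is only semidefinite; strictness comes from [A]. *)
Lemma posdef_add_congr m n (A : 'M[R]_n) (C : 'M[R]_m) (B : 'M[R]_(n, m)) :
  posdef A -> posdef C -> posdef (A + B *m C *m B^T).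
Proof.
move=> [tA A0] Cpd; split.
  by rewrite linearD/= tA !trmx_mul trmxK Cpd.1 mulmxA.
move=> x x0; rewrite quadD -[in X in quad (X *m _ *m _)](trmxK B) -quad_congr.
by rewrite ltr_pwDl ?A0 ?quad_ge0.
Qed.

Lemma det_schur m n (A : 'M[R]_m) (B : 'M[R]_(m, n)) (C : 'M[R]_(n, m))
    (D : 'M[R]_n) : A \in unitmx ->
  \det (block_mx A B C D) = \det A * \det (D - C *m invmx A *m B).
Proof.
move=> uA.
have -> : block_mx A B C D = block_mx 1%:M 0 (C *m invmx A) 1%:M *m
    block_mx A B 0 (D - C *m invmx A *m B).
  rewrite mulmx_block !mul1mx !mul0mx !addr0 mulmxKV//.
  by rewrite addrCA subrr addr0.
by rewrite det_mulmx det_lblock det_ublock !det1 !mul1r.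
Qed.

Lemma det_schur_dr m n (A : 'M[R]_m) (B : 'M[R]_(m, n)) (C : 'M[R]_(n, m))
    (D : 'M[R]_n) : D \in unitmx ->
  \det (block_mx A B C D) = \det D * \det (A - B *m invmx D *m C).
Proof.
move=> uD.
have -> : block_mx A B C D = block_mx 1%:M (B *m invmx D) 0 1%:M *m
    block_mx (A - B *m invmx D *m C) 0 C D.
  rewrite mulmx_block !mul1mx !mul0mx ?add0r mulmxKV//.
  by rewrite subrK.
by rewrite det_mulmx det_lblock det_ublock !det1 !mul1r mulrC.
Qed.

(** Matrix determinant lemma: the block matrix with rows [invmx C, - B^T] and [B, A] is expanded
    along either diagonal block. *)
Lemma det_add_congr m n (A : 'M[R]_n) (C : 'M[R]_m) (B : 'M[R]_(n, m)) :
  A \in unitmx -> C \in unitmx ->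
  \det (A + B *m C *m B^T) =
  \det A * \det C * \det (invmx C + B^T *m invmx A *m B).
Proof.
move=> uA uC.
have uC' : invmx C \in unitmx by rewrite unitmx_inv.
have := det_schur (- B^T) B A uC'.
rewrite det_schur_dr// invmxK mulmxN opprK !mulNmx opprK det_inv.
move=> E; rewrite mulrAC E mulrAC mulVr ?mul1r// -unitmxE.
Qed.

Lemma quadB n (A : 'M[R]_n) (x y : 'cV[R]_n) : A^T = A ->
  quad A (x - y) = quad A x - 2 * (x^T *m A *m y) 0 0 + quad A y.
Proof.
move=> tA; have -> : quad A (x - y) =
    quad A x - (x^T *m A *m y) 0 0 - (y^T *m A *m x) 0 0 + quad A y.
  rewrite /quad [(x - y)^T]linearB/= mulmxBl mulmxBl !mulmxBr.
  by rewrite !mxE; ring.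
have -> : y^T *m A *m x = x^T *m A *m y.
  by rewrite -[LHS]trmx11 !trmx_mul tA trmxK mulmxA.
by ring.
Qed.

(** Woodbury identity, checked by multiplying by [S]. Since [C B^T A^-1 B = C L - 1], one gets
    [S A^-1 B = B + B (C L - 1) = B C L], and [invmx L] cancels. *)
Lemma invmx_add_congr m n (A : 'M[R]_n) (C : 'M[R]_m) (B : 'M[R]_(n, m)) :
  posdef A -> posdef C ->
  invmx (A + B *m C *m B^T) = invmx A - invmx A *m B *m
    invmx (invmx C + B^T *m invmx A *m B) *m B^T *m invmx A.
Proof.
move=> Apd Cpd; set L := invmx C + _; set S := A + _; set W := RHS.
have uS : S \in unitmx by apply/posdef_unit/posdef_add_congr.
have uL : L \in unitmx.
  apply: posdef_unit; rewrite /L -[X in _ + _ *m X]trmxK.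
  by apply: posdef_add_congr; exact: posdef_inv.
have uA := posdef_unit Apd; have uC := posdef_unit Cpd.
suff SW : S *m W = 1%:M by rewrite -[RHS](mulKmx uS) SW mulmx1.
have CL : C *m (B^T *m invmx A *m B) = C *m L - 1%:M.
  by rewrite /L mulmxDr mulmxV// addrC addKr.
rewrite /W mulmxBr !mulmxA.
have -> : S *m invmx A *m B *m invmx L = B *m C.
  have -> : S *m invmx A *m B = B *m C *m L.
    rewrite /S mulmxDl mulmxDl mulmxV// mul1mx -!mulmxA.
    rewrite [B^T *m _]mulmxA CL mulmxBr mulmx1.
    by rewrite addrCA subrr addr0.
  by rewrite mulmxK.
by rewrite /S mulmxDl mulmxV// addrK.
Qed.

(* Completing the square in r. *)
Lemma quad_add_congr m n (A : 'M[R]_n) (C : 'M[R]_m) (B : 'M[R]_(n, m)) r y :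
  posdef A -> posdef C ->
  let L := invmx C + B^T *m invmx A *m B in
  quad (invmx C) r + quad (invmx A) (y - B *m r) =
  quad L (r - invmx L *m B^T *m invmx A *m y) +
  quad (invmx (A + B *m C *m B^T)) y.
Proof.
move=> Apd Cpd L.
have Lpd : posdef L.
  rewrite /L -[X in _ + _ *m X]trmxK.
  by apply: posdef_add_congr; exact: posdef_inv.
have uL := posdef_unit Lpd.
rewrite invmx_add_congr// -/L.
rewrite !quadB ?posdef_tr_inv//; last exact: Lpd.1.
rewrite [quad L r]quadD -quad_congr.
(* [z] is the conditional mean of [r] given [y]; knowing [L z] removes [invmx L] from the cross
   term. *)
set z := invmx L *m _ *m _ *m _.
have Lz : L *m z = B^T *m invmx A *m y by rewrite /z -!mulmxA mulKVmx.
have -> : r^T *m L *m z = y^T *m invmx A *m (B *m r).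
  rewrite -mulmxA Lz -[LHS]trmx11 !trmx_mul !trmxK posdef_tr_inv//.
  by rewrite !mulmxA.
have -> : quad L z = quad (invmx A *m B *m invmx L *m B^T *m invmx A) y.
  rewrite /quad -mulmxA Lz /z !trmx_mul !trmxK !posdef_tr_inv//.
  by rewrite !mulmxA.
have -> : forall X Y, quad (X - Y) y = quad X y - quad Y y.
  by move=> X Y; rewrite /quad mulmxBr mulmxBl !mxE.
by ring.
Qed.

(** * Elimination of the first coordinate *)

Section schur.
Variables (n : nat) (L : 'M[R]_(1 + n)).
Hypothesis Lpd : posdef L.

Let l := L 0 0.
Let c := dlsubmx L.

(** Schur complement of the corner entry. If [L] is the inverse covariance of a Gaussian vector,
    this is the inverse covariance of its last [n] coordinates. *)
Definition schur : 'M[R]_n := drsubmx L - l^-1 *: (c *m c^T).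

Let ulsubmxE : ulsubmx L = l%:M.
Proof.
apply/matrixP => i j; rewrite !ord1 !mxE eqxx mulr1n /l.
by congr (L _ _); apply: val_inj.
Qed.

Let ursubmxE : ursubmx L = c^T.
Proof. by rewrite /c trmx_dlsub Lpd.1. Qed.

Lemma posdef00_gt0 : 0 < L 0 0.
Proof.
have := Lpd.2 (delta_mx 0 0); rewrite /quad trmx_delta -rowE -colE !mxE; apply.
apply/eqP => /matrixP/(_ 0 0)/eqP.
by rewrite !mxE !eqxx oner_eq0.
Qed.

Let u : 'M[R]_(1 + n) := block_mx 1%:M (l^-1 *: c^T) 0 1%:M.

(** One step of the LDL^T factorization. As [u] is unitriangular, both the completed square and the
    determinant can be read off it. *)
Let LE : L = u^T *m block_mx l%:M 0 0 schur *m u.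
Proof.
have l0 : l != 0 by rewrite gt_eqF// posdef00_gt0.
rewrite /u (tr_block_mx 1%:M) !mulmx_block !trmx1 !trmx0 !mulmx0 !mul0mx.
rewrite !mul1mx !mulmx1 ?addr0 ?add0r.
rewrite -[LHS]submxK ulsubmxE ursubmxE -/c [(_ *: _)^T]linearZ/= trmxK.
rewrite mul_mx_scalar mul_scalar_mx !scalerA divff// !scale1r -scalemxAr.
by rewrite /schur addrC subrK.
Qed.

Lemma quad_col_mx (a : R) (x : 'cV[R]_n) :
  quad L (col_mx a%:M x) =
  L 0 0 * (a + (L 0 0)^-1 * ((dlsubmx L)^T *m x) 0 0) ^+ 2 + quad schur x.
Proof.
rewrite -/l -/c {1}LE -quad_congr /u mul_block_col !mul1mx mul0mx add0r.
set b := _ + _.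
have -> : quad (block_mx l%:M 0 0 schur) (col_mx b x) =
    l * b 0 0 ^+ 2 + quad schur x.
  rewrite /quad tr_col_mx mul_row_block mul_row_col !mulmx0 addr0 add0r.
  by rewrite mul_mx_scalar !mxE big_ord1 !mxE expr2 mulrA.
by rewrite /b -scalemxAl !mxE mulr1n.
Qed.

Lemma posdef_schur : posdef schur.
Proof.
split.
  rewrite /schur linearB/= trmx_drsub Lpd.1; congr (_ - _).
  by rewrite linearZ/= trmx_mul trmxK.
move=> x x0.
(* The first coordinate that makes the square in [quad_col_mx] vanish. *)
pose a := - ((L 0 0)^-1 * ((dlsubmx L)^T *m x) 0 0).
have : 0 < quad L (col_mx a%:M x).
  apply: Lpd.2; apply: contra x0 => /eqP/(congr1 dsubmx).
  by rewrite col_mxKd => ->; apply/eqP/matrixP => i j; rewrite !mxE.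
by rewrite quad_col_mx addNr expr0n mulr0 add0r.
Qed.

Lemma det_schurE : \det L = L 0 0 * \det schur.
Proof.
have l0 : l != 0 by rewrite gt_eqF// posdef00_gt0.
rewrite [in LHS]LE !det_mulmx det_tr !(det_ublock 1%:M) !det1 !mul1r mulr1.
by rewrite det_ublock det_scalar1.
Qed.

End schur.

Lemma posdef_det_gt0 n (A : 'M[R]_n) : posdef A -> 0 < \det A.
Proof.
elim: n A => [A _|n IH A Apd]; first by rewrite det_mx00.
rewrite (det_schurE Apd) mulr_gt0 ?IH//; first exact: posdef00_gt0.
exact: posdef_schur.
Qed.

End quadratic_forms.

(** * Lebesgue measure on column vectors *)

Section measurable_matrix.
Context d (T : measurableType d) (R : realType).

Lemma measurable_mulmx m n p (f : T -> 'M[R]_(m, n)) (g : T -> 'M[R]_(n, p)) :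
  measurable_fun setT f -> measurable_fun setT g ->
  measurable_fun setT (fun t => f t *m g t).
Proof.
move=> /measurable_fun_mxP mf /measurable_fun_mxP mg.
apply/measurable_fun_mxP => i j.
under eq_fun do rewrite mxE.
by apply: measurable_sum => k; exact: measurable_funM.
Qed.

Lemma measurable_addmx m n (f g : T -> 'M[R]_(m, n)) :
  measurable_fun setT f -> measurable_fun setT g ->
  measurable_fun setT (fun t => f t + g t).
Proof.
move=> /measurable_fun_mxP mf /measurable_fun_mxP mg.
apply/measurable_fun_mxP => i j.
by under eq_fun do rewrite mxE; exact: measurable_funD.
Qed.

Lemma measurable_oppmx m n (f : T -> 'M[R]_(m, n)) :
  measurable_fun setT f -> measurable_fun setT (fun t => - f t).
Proof.
move=> /measurable_fun_mxP mf; apply/measurable_fun_mxP => i j.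
by under eq_fun do rewrite mxE; exact: measurableT_comp.
Qed.

Lemma measurable_trmx m n (f : T -> 'M[R]_(m, n)) :
  measurable_fun setT f -> measurable_fun setT (fun t => (f t)^T).
Proof.
move=> /measurable_fun_mxP mf; apply/measurable_fun_mxP => i j.
under eq_fun do rewrite mxE; exact: mf.
Qed.

Lemma measurable_quad n (A : 'M[R]_n) (f : T -> 'cV[R]_n) :
  measurable_fun setT f -> measurable_fun setT (fun t => quad A (f t)).
Proof.
move=> mf; apply: (measurable_fun_mxP _).1.
apply: measurable_mulmx => //.
by apply: measurable_mulmx => //; exact: measurable_trmx.
Qed.

End measurable_matrix.

(** * Iterated integration and translation invariance *)

Section lebesgue_cV.
Context (R : realType).
Local Notation mu := (@lebesgue_measure R).
Local Open Scope ereal_scope.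

(** Tonelli, with the first coordinate innermost: this is the order in which [quad_col_mx] completes
    the square. *)
Lemma ge0_integral_lebesgue_cVS n (f : 'cV[R]_n.+1 -> \bar R) :
  measurable_fun setT f -> (forall x, 0 <= f x) ->
  \int[lebesgue_cV R n.+1]_x f x =
  \int[lebesgue_cV R n]_x \int[mu]_a f (cV_cons (a, x)).
Proof.
move=> mf f0.
have mfc : measurable_fun setT (fun p : measurableTypeR R * 'cV[R]_n => f (cV_cons p)).
  by apply: measurableT_comp => //; exact: measurable_cV_cons.
rewrite [LHS](ge0_integral_pushforward (@measurable_cV_cons R n))//=.
rewrite preimage_setT /sfprod_measure.
by rewrite (fubini_tonelli2 (fun p : measurableTypeR R * 'cV[R]_n => f (cV_cons p))).
Qed.

Lemma ge0_integral_lebesgue_cV0 (f : 'cV[R]_0 -> \bar R) :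
  measurable_fun setT f ->
  \int[lebesgue_cV R 0]_x f x = f 0%R.
Proof. by move=> mf; rewrite /= integral_dirac// diracT mul1e. Qed.

(** The image of [mu] under the translation gives half-open intervals their length, hence is [mu] by
    uniqueness. *)
Lemma ge0_integral_translation (f : measurableTypeR R -> \bar R) (c : R) :
  measurable_fun setT f -> (forall x, 0 <= f x) ->
  \int[mu]_x f (x + c)%R = \int[mu]_x f x.
Proof.
move=> mf f0.
have mc : measurable_fun setT (fun x : measurableTypeR R => (x + c)%R : measurableTypeR R).
  exact: measurable_funD.
rewrite [RHS](eq_measure_integral (pushforward mu (fun x : measurableTypeR R => (x + c)%R : measurableTypeR R))).
  by rewrite ge0_integral_pushforward.

move=> A mA _; apply: lebesgue_measure_unique => // _ [[a b] _ <-].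
transitivity (mu `](a - c)%R, (b - c)%R]%classic).
  rewrite !lebesgue_measure_itv/= !lte_fin ltrD2r; case: ifP => // _.
  by rewrite -!EFinD; congr EFin; ring.
congr (mu _); apply/seteqP.
by split => x/=; rewrite !in_itv/= ltrBlDr lerBrDr.
Qed.

Lemma measurable_cV_consl n (x : 'cV[R]_n) :
  measurable_fun setT (fun a : measurableTypeR R => cV_cons (a, x)).
Proof. exact: (measurableT_comp (@measurable_cV_cons R n)). Qed.

Lemma cV_consD n (a b : R) (x y : 'cV[R]_n) :
  (cV_cons (a, x) + cV_cons (b, y) = cV_cons ((a + b)%R, (x + y)%R))%R.
Proof. by rewrite /cV_cons/= (@add_col_mx _ 1 n) -raddfD. Qed.

Lemma ge0_integral_lebesgue_cV_translation n (f : 'cV[R]_n -> \bar R) (c : 'cV[R]_n) :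
  measurable_fun setT f -> (forall x, 0 <= f x) ->
  \int[lebesgue_cV R n]_x f (x + c)%R = \int[lebesgue_cV R n]_x f x.
Proof.
elim: n f c => [|n IH] f c mf f0.
  by apply: eq_integral => x _; congr f; apply/matrixP => -[].
have mfc : measurable_fun setT (fun x : 'cV[R]_n.+1 => f (x + c)%R).
  by apply: measurableT_comp => //; exact: measurable_addmx.
rewrite !ge0_integral_lebesgue_cVS//.
rewrite -[RHS](IH _ (cV_uncons c).2); last 2 first.
- apply: (measurable_fun_fubini_tonelli_G (m1 := mu)
    (fun p : measurableTypeR R * 'cV[R]_n => f (cV_cons p))) => //.
  by apply: measurableT_comp => //; exact: measurable_cV_cons.
- by move=> x; exact: integral_ge0.
apply: eq_integral => x _.
rewrite -[RHS](ge0_integral_translation (cV_uncons c).1)//; last first.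
  by apply: measurableT_comp => //; exact: measurable_cV_consl.
apply: eq_integral => a _.
by rewrite -{1}(cV_unconsK c) cV_consD.
Qed.

End lebesgue_cV.

(** * Gaussian integrals *)

Section gaussian_integrals.
Context (R : realType).
Local Notation mu := (@lebesgue_measure R).
Local Open Scope ereal_scope.

(** Normalization of [normal_pdf] with mean [- m] and standard deviation [s = l^(-1/2)]. *)
Lemma gaussian_integral1 (l m : R) : (0 < l)%R ->
  \int[mu]_a (expR (- (l * (a + m) ^+ 2 / 2)))%:E =
  (Num.sqrt (2 * pi / l))%:E.
Proof.
move=> l0; pose s : R := Num.sqrt l^-1.
have s0 : s != 0%R by rewrite gt_eqF// sqrtr_gt0 invr_gt0.
have sE : (s ^+ 2 = l^-1)%R by rewrite sqr_sqrtr// invr_ge0 ltW.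
have := integral_normal_pdf (- m) s.
under eq_integral do rewrite normal_pdfE//= EFinM.
rewrite ge0_integralZl//=; last 3 first.
- by apply/measurable_EFinP; exact: measurable_normal_fun.
- by move=> x _; rewrite lee_fin normal_fun_ge0.
- by rewrite lee_fin normal_peak_ge0.
have -> : \int[mu]_x (normal_fun (- m) s x)%:E =
    \int[mu]_a (expR (- (l * (a + m) ^+ 2 / 2)))%:E.
  apply: eq_integral => x _; rewrite /normal_fun sE opprK; congr (expR _)%:E.
  by rewrite -mulr_natr; field; rewrite gt_eqF.
move=> E; rewrite -[LHS]mul1e.
have p0 := normal_peak_gt0 s0.
have -> : 1 = (Num.sqrt (2 * pi / l))%:E * (normal_peak s)%:E.
  rewrite -EFinM /normal_peak sE; congr EFin.
  have -> : (l^-1 * pi *+ 2 = 2 * pi / l)%R by rewrite -mulr_natr; ring.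
  by rewrite divff// gt_eqF// sqrtr_gt0 !mulr_gt0// ?pi_gt0// invr_gt0.
by rewrite -muleA E mule1.
Qed.

Lemma measurable_gaussian d (T : measurableType d) n (L : 'M[R]_n)
    (f : T -> 'cV[R]_n) :
  measurable_fun setT f ->
  measurable_fun setT (fun x => (expR (- (quad L (f x) / 2)))%:E).
Proof.
move=> mf; apply/measurable_EFinP; apply: measurableT_comp => //.
apply: measurableT_comp => //; apply: measurable_funM => //.
exact: measurable_quad.
Qed.

(** By induction on [n]: the innermost integral contributes [sqrt (2 pi / L 0 0)] whatever the other
    coordinates are, and leaves the same problem for the Schur complement. *)
Lemma gaussian_integral n (L : 'M[R]_n) (m : 'cV[R]_n) : posdef L ->
  \int[lebesgue_cV R n]_x (expR (- (quad L (x - m) / 2)))%:E =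
  (Num.sqrt ((2 * pi) ^+ n / \det L))%:E.
Proof.
elim: n L m => [|n IH] L m Lpd.
  rewrite ge0_integral_lebesgue_cV0; last first.
    by apply: measurable_gaussian; exact: measurable_addmx.
 rewrite det_mx00 expr0 divr1 sqrtr1.
  have -> : (0 - m = 0 :> 'cV[R]_0)%R by apply/matrixP => -[].
  by rewrite quad0 mul0r oppr0 expR0.
have l0 := posdef00_gt0 Lpd.
rewrite ge0_integral_lebesgue_cVS//; last first.
  by apply: measurable_gaussian; exact: measurable_addmx.
pose m0 := (cV_uncons m).1; pose m1 := (cV_uncons m).2.
transitivity (\int[lebesgue_cV R n]_x
    ((Num.sqrt (2 * pi / L ord0 ord0))%:E *
     (expR (- (quad (@schur _ n L) (x - m1) / 2)))%:E)).
  apply: eq_integral => x _.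
  (* For fixed [x], the exponent is centered at [a = - t]. *)
  pose t : R := ((L ord0 ord0)^-1 *
    ((@dlsubmx _ 1 n 1 n L)^T *m (x - m1)) ord0 ord0 - m0)%R.
  rewrite -(gaussian_integral1 t)// muleC -ge0_integralZl//; last first.
    apply/measurable_EFinP; apply: measurableT_comp => //.
    apply: measurableT_comp => //; apply: measurable_funM => //.
    apply: measurable_funM => //; apply: measurable_funX.
    exact: measurable_funD.
  apply: eq_integral => a _; rewrite -EFinM -expRD; congr (expR _)%:E.
  have -> : (cV_cons (a, x) - m)%R = col_mx (a - m0)%R%:M (x - m1)%R.
    rewrite -{1}(cV_unconsK m) /cV_cons/= -/m0 -/m1.
    by rewrite (@opp_col_mx _ 1) (@add_col_mx _ 1) -raddfN -raddfD.
  by rewrite quad_col_mx// /t; ring.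
rewrite ge0_integralZl//; last first.
  by apply: measurable_gaussian; exact: measurable_addmx.
rewrite (IH _ _ (posdef_schur Lpd)) (det_schurE Lpd) -EFinM -sqrtrM; last first.
  by rewrite !mulr_ge0// ?pi_ge0// invr_ge0 ltW.
congr (Num.sqrt _)%:E.
rewrite invfM exprS; ring.
Qed.

(** A Bernoulli bound valid on both sides of 1: the induction increment is a nonnegative multiple of
    [(u - 1) ^+ 2]. For [u < 1] it bounds [1 - u ^+ n] from below. *)
Lemma exprB1_le n (u : R) : (0 <= u -> u ^+ n - 1 <= n%:R * u ^+ n * (u - 1))%R.
Proof.
move=> u0; elim: n => [|n IH]; first by rewrite expr0 subrr !mul0r.
rewrite -subr_ge0.
have -> : (n.+1%:R * u ^+ n.+1 * (u - 1) - (u ^+ n.+1 - 1) =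
  (n%:R * u ^+ n * (u - 1) - (u ^+ n - 1)) + n.+1%:R * (u ^+ n * (u - 1) ^+ 2))%R.
  by rewrite exprS -natr1; ring.
by rewrite addr_ge0 ?subr_ge0// mulr_ge0// mulr_ge0 ?sqr_ge0 ?exprn_ge0.
Qed.

(** Both bounds tend to [a] as [u] tends to 1, from the right and from the left respectively. *)
Lemma expr_squeeze1 (J a : R) (n : nat) :
  (forall u, 1 < u -> J <= a * u ^+ n)%R ->
  (forall u, 0 < u -> u < 1 -> a * u ^+ n <= J)%R -> J = a.
Proof.
move=> Jle Jge.
have c1 : (a * u ^+ n)%R @[u --> (1 : R)%R] --> a.
  rewrite -[X in _ --> X]mulr1 -[X in (_ * X)%R](expr1n R n).
  by apply: cvgM; [exact: cvg_cst|exact: exprn_continuous].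
apply/eqP; rewrite eq_le; apply/andP; split.
  apply: (cvgr_to_ge (cvg_at_right_filter c1)).
  by near=> u; apply: Jle; near: u; exact: nbhs_right_gt.
apply: (cvgr_to_le (cvg_at_left_filter c1)).
near=> u; apply: Jge; near: u; first exact: nbhs_left_gt.
exact: nbhs_left_lt.
Unshelve. all: by end_near. Qed.

(* Compare the Gaussian integrals of L and of L / u^2 for u close to 1, using
   exp(-q/2) * (1 - d) <= exp(-q/2 - d) with d = (u^-2 - 1) q / 2. *)
Lemma gaussian_integral_quad n (L : 'M[R]_n) (m : 'cV[R]_n) : posdef L ->
  \int[lebesgue_cV R n]_x
    (quad L (x - m) * expR (- (quad L (x - m) / 2)))%:E =
  (n%:R * Num.sqrt ((2 * pi) ^+ n / \det L))%:E.
Proof.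
move=> Lpd; set C := Num.sqrt _.
have C0 : (0 < C)%R.
  by rewrite sqrtr_gt0 divr_gt0 ?posdef_det_gt0// exprn_gt0// mulr_gt0// pi_gt0.
have mL : measurable_fun [set: 'cV[R]_n]
    (fun x : 'cV[R]_n => (expR (- (quad L (x - m) / 2)))%:E).
  by apply: measurable_gaussian; exact: measurable_addmx.
have mqL : measurable_fun [set: 'cV[R]_n] (fun x : 'cV[R]_n =>
    (quad L (x - m) * expR (- (quad L (x - m) / 2)))%:E).
  apply/measurable_EFinP; apply: measurable_funM; last exact/measurable_EFinP.
  by apply: measurable_quad; exact: measurable_addmx.
have mu_ (u : R) : measurable_fun [set: 'cV[R]_n]
    (fun x : 'cV[R]_n => (expR (- (u ^- 2 * quad L (x - m) / 2)))%:E).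
  under eq_fun do rewrite -quad_scale.
  by apply: measurable_gaussian; exact: measurable_addmx.
have gu (u : R) : (0 < u)%R -> \int[lebesgue_cV R n]_x
    (expR (- (u ^- 2 * quad L (x - m) / 2)))%:E = (u ^+ n * C)%:E.
  move=> u0; under eq_integral do rewrite -quad_scale.
  rewrite gaussian_integral; last by apply: posdef_scale; rewrite ?invr_gt0 ?exprn_gt0.
  rewrite detZ /C; congr EFin.
  have -> : (u ^+ n = Num.sqrt ((u ^+ n) ^+ 2))%R.
    by rewrite sqrtr_sqr ger0_norm// exprn_ge0// ltW.
  rewrite -sqrtrM ?sqr_ge0//.
  congr Num.sqrt; rewrite invfM -exprVn invrK -exprM mulnC exprM.
  by rewrite mulrCA mulrA.
have q0 x : (0 <= quad L x)%R by exact: quad_ge0.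
set I := \int[_]_x _.
have I0 : 0 <= I by apply: integral_ge0 => x _; rewrite lee_fin mulr_ge0// expR_ge0.
have expRle (u q : R) :
    (expR (- (q / 2)) * (1 - (u ^- 2 - 1) / 2 * q) <= expR (- (u ^- 2 * q / 2)))%R.
  rewrite -ler_pdivlMl ?expR_gt0// -expRN -expRD.
  apply: le_trans (expR_ge1Dx _) _; rewrite ler_expR.
  by lra.
have qe0 x : (0 <= quad L (x - m) * expR (- (quad L (x - m) / 2)))%R.
  by rewrite mulr_ge0// expR_ge0.
(* [I] may still be infinite here, so each of the two comparisons is arranged with nonnegative
   coefficients only: [u ^- 2 - 1] for [u < 1], and [1 - u ^- 2] moved to the other side for
   [u > 1]. *)
have Ige (u : R) : (0 < u)%R -> (u < 1)%R ->
    C%:E <= (u ^+ n * C)%:E + ((u ^- 2 - 1) / 2)%:E * I.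
  move=> u0 u1.
  have d0 : (0 <= (u ^- 2 - 1) / 2)%R.
    by rewrite divr_ge0// subr_ge0 invf_ge1 ?exprn_gt0// exprn_ile1// ltW.
  rewrite -gu// /C -(gaussian_integral m Lpd) -ge0_integralZl//; last first.
    by move=> x _; rewrite lee_fin.
  rewrite -ge0_integralD//; last 2 first.
  - by move=> x _; rewrite mule_ge0// lee_fin.
  - exact: measurable_funeM.
  apply: ge0_le_integral => //.
    by apply: emeasurable_funD => //; exact: measurable_funeM.
  move=> x _; rewrite -EFinM -EFinD lee_fin.
  by have := expRle u (quad L (x - m)); lra.
have Ile (u : R) : (1 < u)%R ->
    C%:E + ((1 - u ^- 2) / 2)%:E * I <= (u ^+ n * C)%:E.
  move=> u1; have u0 : (0 < u)%R by exact: lt_trans u1.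
  have d0 : (0 <= (1 - u ^- 2) / 2)%R.
    by rewrite divr_ge0// subr_ge0 invf_le1 ?exprn_gt0// exprn_ege1// ltW.
  rewrite -gu// /C -(gaussian_integral m Lpd) -ge0_integralZl//; last first.
    by move=> x _; rewrite lee_fin.
  rewrite -ge0_integralD//; last 2 first.
  - by move=> x _; rewrite mule_ge0// lee_fin.
  - exact: measurable_funeM.
  apply: ge0_le_integral => //.
  - by move=> x _; rewrite adde_ge0 ?mule_ge0 ?lee_fin ?expR_ge0.
  - by apply: emeasurable_funD => //; exact: measurable_funeM.
  - move=> x _; rewrite -EFinM -EFinD lee_fin.
    by have := expRle u (quad L (x - m)); lra.
have Ifin : I \is a fin_num.
  rewrite ge0_fin_numE//; apply/negP => /negP; rewrite -leNgt leye_eq => /eqP Iy.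
  (* Any [u > 1] would do: the coefficient of [I] is positive and the right-hand side is finite. *)
  have := Ile 2%R (ltr1n R 2); rewrite Iy gt0_muley ?lte_fin; last first.
    by rewrite divr_gt0// subr_gt0 invf_lt1 ?exprn_gt0// exprn_egt1// ltr1n.
  by rewrite addey.
rewrite -(fineK Ifin) in Ige Ile *; set J := fine I in Ige Ile *.
congr EFin; apply: (@mulIf _ C^-1).
  by rewrite invr_eq0 gt_eqF.
rewrite mulfK ?gt_eqF//.
have J0 : (0 <= J)%R by exact: fine_ge0.
(* Here [J / C] is squeezed to [n]. Multiplying by [u ^+ 2] clears [u ^- 2], whence the exponent
   [n.+2]; then [|u - 1|] is divided out, and the remaining factor [(u + 1) / 2] is compared with
   1. *)
apply: (@expr_squeeze1 _ _ n.+2) => u.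
- move=> u1; have u0 : (0 < u)%R by exact: lt_trans u1.
  have := Ile u u1; rewrite -EFinM -EFinD lee_fin => H.
  have B := exprB1_le n (ltW u0).
  rewrite ler_pdivrMr// -(ler_pM2l (_ : 0 < u - 1)%R) ?subr_gt0//.
  apply: (@le_trans _ _ (u ^+ 2 * ((1 - u ^- 2) / 2 * J)))%R.
    have -> : (u ^+ 2 * ((1 - u ^- 2) / 2 * J) = (u - 1) * ((u + 1) / 2 * J))%R.
      by field; rewrite gt_eqF.
    rewrite ler_pM2l ?subr_gt0// ler_peMl//; lra.
  apply: (@le_trans _ _ (u ^+ 2 * ((u ^+ n - 1) * C)))%R.
    by rewrite ler_pM2l ?exprn_gt0//; lra.
  have -> : ((u - 1) * (n%:R * u ^+ n.+2 * C) =
      u ^+ 2 * (n%:R * u ^+ n * (u - 1) * C))%R by rewrite !exprS; ring.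
  by rewrite ler_pM2l ?exprn_gt0// ler_pM2r.
- move=> u0 u1.
  have := Ige u u0 u1; rewrite -EFinM -EFinD lee_fin => H.
  have B := exprB1_le n (ltW u0).
  rewrite ler_pdivlMr// -(ler_pM2l (_ : 0 < 1 - u)%R) ?subr_gt0//.
  apply: (@le_trans _ _ (u ^+ 2 * ((u ^- 2 - 1) / 2 * J)))%R; last first.
    have -> : (u ^+ 2 * ((u ^- 2 - 1) / 2 * J) = (1 - u) * ((u + 1) / 2 * J))%R.
      by field; rewrite gt_eqF.
    rewrite ler_pM2l ?subr_gt0// ler_piMl//; lra.
  apply: (@le_trans _ _ (u ^+ 2 * ((1 - u ^+ n) * C)))%R; last first.
    by rewrite ler_pM2l ?exprn_gt0//; lra.
  have -> : ((1 - u) * (n%:R * u ^+ n.+2 * C) =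
      u ^+ 2 * (n%:R * u ^+ n * (1 - u) * C))%R by rewrite !exprS; ring.
  by rewrite ler_pM2l ?exprn_gt0// ler_pM2r//; lra.
Qed.

End gaussian_integrals.

(** * Gaussian densities *)

Section mvnormal_pdf.
Context (R : realType).

Lemma mvnormal_pdfE n (m : 'cV[R]_n) S x : mvnormal_pdf m S x =
  (Num.sqrt ((2 * pi) ^+ n * \det S))^-1 *
  expR (- (quad (invmx S) (x - m) / 2)).
Proof. by []. Qed.

Lemma mvnormal_pdf_ge0 n (m : 'cV[R]_n) S x : 0 <= mvnormal_pdf m S x.
Proof. by rewrite mulr_ge0 ?expR_ge0// invr_ge0 sqrtr_ge0. Qed.

Lemma mvnormal_peak_gt0 n (S : 'M[R]_n) : posdef S ->
  0 < Num.sqrt ((2 * pi) ^+ n * \det S).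
Proof.
move=> Spd; rewrite sqrtr_gt0 mulr_gt0 ?posdef_det_gt0//.
by rewrite exprn_gt0// mulr_gt0// pi_gt0.
Qed.

Lemma mvnormal_pdf_gt0 n (m : 'cV[R]_n) S x :
  posdef S -> 0 < mvnormal_pdf m S x.
Proof.
by move=> Spd; rewrite mulr_gt0 ?expR_gt0// invr_gt0 mvnormal_peak_gt0.
Qed.

(** The logarithm of the density at its mean; the entropies depend on a covariance only through this
    number. *)
Definition ln_peak n (S : 'M[R]_n) : R :=
  - ln (Num.sqrt ((2 * pi) ^+ n * \det S)).

Lemma ln_mvnormal_pdf n (m : 'cV[R]_n) S x : posdef S ->
  ln (mvnormal_pdf m S x) = ln_peak S - quad (invmx S) (x - m) / 2.
Proof.
move=> Spd; have p0 := mvnormal_peak_gt0 Spd.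
by rewrite mvnormal_pdfE lnM ?posrE ?expR_gt0 ?invr_gt0// lnV ?posrE// expRK.
Qed.

Lemma measurable_mvnormal_pdf d (T : measurableType d) n (S : 'M[R]_n)
    (f g : T -> 'cV[R]_n) :
  measurable_fun setT f -> measurable_fun setT g ->
  measurable_fun setT (fun t => mvnormal_pdf (g t) S (f t)).
Proof.
move=> mf mg; apply: measurable_funM => //.
apply/measurable_EFinP; apply: measurable_gaussian.
by apply: measurable_addmx => //; exact: measurable_oppmx.
Qed.

Local Open Scope ereal_scope.

Lemma sqrt_gaussian_integral n (S : 'M[R]_n) :
  (Num.sqrt ((2 * pi) ^+ n / \det (invmx S)) =
   Num.sqrt ((2 * pi) ^+ n * \det S))%R.
Proof. by rewrite det_inv invrK. Qed.

Lemma integral_mvnormal_pdf n (S : 'M[R]_n) (m : 'cV[R]_n) : posdef S ->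
  \int[lebesgue_cV R n]_x (mvnormal_pdf m S x)%:E = 1.
Proof.
move=> Spd; under eq_integral do rewrite mvnormal_pdfE EFinM.
rewrite ge0_integralZl//; last first.
  by apply: measurable_gaussian; exact: measurable_addmx.
rewrite gaussian_integral; last exact: posdef_inv.
rewrite sqrt_gaussian_integral -EFinM mulVf//.
by rewrite gt_eqF// mvnormal_peak_gt0.
Qed.

Lemma integral_mvnormal_pdf_quad n (S : 'M[R]_n) (m : 'cV[R]_n) : posdef S ->
  \int[lebesgue_cV R n]_x
    (mvnormal_pdf m S x * quad (invmx S) (x - m))%:E = n%:R%:E.
Proof.
move=> Spd; have Spd' := posdef_inv Spd.
under eq_integral do rewrite mvnormal_pdfE -mulrA [(expR _ * _)%R]mulrC EFinM.
rewrite ge0_integralZl//; last 2 first.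
- apply/measurable_EFinP; apply: measurable_funM.
    by apply: measurable_quad; exact: measurable_addmx.
  by apply/measurable_EFinP; apply: measurable_gaussian; exact: measurable_addmx.
- by move=> x _; rewrite lee_fin mulr_ge0 ?quad_ge0 ?expR_ge0.
rewrite gaussian_integral_quad// sqrt_gaussian_integral -EFinM mulrCA mulVf ?mulr1//.
by rewrite gt_eqF// mvnormal_peak_gt0.
Qed.

(** By [quad_add_congr], the integrand is a factor depending on [y] alone times an unnormalized
    Gaussian in [x] centered at [z], with matrix [L]. *)
Lemma mvnormal_pdf_conv m n (A : 'M[R]_n) (C : 'M[R]_m) (B : 'M[R]_(n, m)) y :
  posdef A -> posdef C ->
  \int[lebesgue_cV R m]_x
    (mvnormal_pdf 0 C x * mvnormal_pdf (B *m x) A y)%:E =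
  (mvnormal_pdf 0 (A + B *m C *m B^T)%R y)%:E.
Proof.
move=> Apd Cpd; set S := (A + _)%R.
have Spd : posdef S by exact: posdef_add_congr.
pose L := (invmx C + B^T *m invmx A *m B)%R.
have Lpd : posdef L.
  rewrite /L -[X in (_ + _ *m X)%R]trmxK.
  by apply: posdef_add_congr; exact: posdef_inv.
pose z := invmx L *m B^T *m invmx A *m y.
pose cA := Num.sqrt ((2 * pi) ^+ n * \det A).
pose cC := Num.sqrt ((2 * pi) ^+ m * \det C).
pose k : R := (cA^-1 * cC^-1 * expR (- (quad (invmx S) y / 2)))%R.
have k0 : (0 <= k)%R by rewrite !mulr_ge0 ?expR_ge0// invr_ge0 sqrtr_ge0.
transitivity (\int[lebesgue_cV R m]_x
    (k%:E * (expR (- (quad L (x - z) / 2)))%:E)).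
  apply: eq_integral => x _; rewrite -EFinM; congr EFin.
  rewrite !mvnormal_pdfE -/cA -/cC subr0 /k.
  have /= := quad_add_congr B x y Apd Cpd; rewrite -/L -/S -/z => E.
  transitivity (cA^-1 * cC^-1 * expR (- (quad (invmx C) x / 2) -
     quad (invmx A) (y - B *m x) / 2))%R.
    by rewrite expRD; ring.
  rewrite -[RHS]mulrA -expRD; congr (_ * expR _)%R.
  by rewrite -!opprD -!mulrDl E addrC.
rewrite ge0_integralZl//; last first.
  by apply: measurable_gaussian; exact: measurable_addmx.
rewrite gaussian_integral// -EFinM; congr EFin.
rewrite mvnormal_pdfE subr0 /k mulrAC; congr (_ * _)%R.
have pi20 j : (0 < (2 * pi : R) ^+ j)%R.
  by rewrite exprn_gt0// mulr_gt0// pi_gt0.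
rewrite /cA /cC -!sqrtrV ?mulr_ge0 ?ltW ?posdef_det_gt0//.
have dA := posdef_det_gt0 Apd; have dC := posdef_det_gt0 Cpd.
have dL := posdef_det_gt0 Lpd.
rewrite -!sqrtrM ?invr_ge0 ?mulr_ge0 ?invr_ge0 ?mulr_ge0 ?ltW//.
congr Num.sqrt.
(* [det S = det A * det C * det L], and the power [(2 * pi) ^+ m] from the integral cancels the one
   in [cC]. *)
rewrite /S det_add_congr ?posdef_unit// -/L.
by field; rewrite !gt_eqF// pi_gt0.
Qed.

End mvnormal_pdf.

(** * Densities and independence *)

Section densities.
Context d (T : measurableType d) (R : realType) (P : probability T R).
Local Open Scope ereal_scope.

(** Unlike [density], this fixes a representative that is defined and nonnegative at every point. *)
Definition has_density d' (V : measurableType d')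
    (mu : {sigma_finite_measure set V -> \bar R}) (X : {RV P >-> V})
    (f : V -> R) : Prop :=
  [/\ measurable_fun setT f, forall x, (0 <= f x)%R &
    forall A, measurable A -> distribution P X A = \int[mu]_(x in A) (f x)%:E].

Section has_density_theory.
Context d' (V : measurableType d').
Variables (mu : {sigma_finite_measure set V -> \bar R}) (X : {RV P >-> V}).
Variable f : V -> R.
Hypothesis Xf : has_density mu X f.

(** Absolute continuity ensures that [density] is a genuine derivative and not the default 0. *)
Lemma has_density_dominates : distribution P X `<< mu.
Proof.
have [mf _ fE] := Xf.
apply/null_content_dominatesP => A mA A0; rewrite fE//.
by apply: null_set_integral => //; exact/measurable_funTS/measurable_EFinP.
Qed.

(** Uniqueness of the Radon-Nikodym derivative: both functions have the same integral over every
    measurable set. This is what lets the entropies be computed with [f]. *)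
Lemma density_ae_eq : {ae mu, forall x, density mu X x = f x}.
Proof.
have [mf _ fE] := Xf; have dX := has_density_dominates.
have : ae_eq mu setT
    (Radon_Nikodym (charge_of_finite_measure (distribution P X)) mu) (EFin \o f).
  apply: integral_ae_eq => //.
  - exact: (@Radon_Nikodym_integrable _ _ _ (charge_of_finite_measure (distribution P X))).
  - exact/measurable_EFinP.
  - by move=> A _ mA; rewrite -Radon_Nikodym_integral// -fE.
by apply: filterS => x /(_ I) E; rewrite /density E.
Qed.

Lemma measurable_density : measurable_fun setT (density mu X).
Proof.
have dX := has_density_dominates.
by apply: measurableT_comp => //; exact: measurable_fine.
Qed.

Lemma ge0_integral_has_density (F : V -> \bar R) :
  measurable_fun setT F -> (forall x, 0 <= F x) ->
  \int[distribution P X]_x F x = \int[mu]_x (F x * (f x)%:E).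
Proof.
move=> mF F0; have [mf f0 fE] := Xf; have dX := has_density_dominates.
rewrite -(Radon_Nikodym_SigmaFinite.change_of_variables dX)//.
have iRN := Radon_Nikodym_SigmaFinite.f_integrable dX.
apply: ae_eq_integral => //.
- by apply: emeasurable_funM => //; exact: measurable_int iRN.
- by apply: emeasurable_funM => //; exact/measurable_EFinP.
- apply: ae_eqe_mul2l; apply: integral_ae_eq => //.
  + exact/measurable_EFinP.
  + move=> A _ mA; rewrite -(Radon_Nikodym_SigmaFinite.f_integral dX)//.
    exact: fE.
Qed.

End has_density_theory.

Definition independent_RV d1 d2 (V1 : measurableType d1) (V2 : measurableType d2)
    (X : {RV P >-> V1}) (Y : {RV P >-> V2}) : Prop :=
  forall A B, measurable A -> measurable B ->
    P (X @^-1` A `&` Y @^-1` B) = P (X @^-1` A) * P (Y @^-1` B).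

Lemma distribution_independent_pair d1 d2 (V1 : measurableType d1)
    (V2 : measurableType d2) (X : {RV P >-> V1}) (Y : {RV P >-> V2}) C :
  independent_RV X Y -> measurable C ->
  distribution P (RV_pair X Y) C = (distribution P X \x distribution P Y) C.
Proof.
by move=> XY mC; apply/esym/product_measure_unique.
Qed.

(* A measure on a product is determined by its values on rectangles. *)
Lemma independent_RV_pair d1 d2 d3 (V1 : measurableType d1)
    (V2 : measurableType d2) (V3 : measurableType d3) (X : {RV P >-> V1})
    (Y : {RV P >-> V2}) (Z : {RV P >-> V3}) :
  mutually_independent3 X Y Z -> independent_RV X (RV_pair Y Z).
Proof.
move=> XYZ A C mA mC.
have mXA : measurable (X @^-1` A) by rewrite -[X in measurable X]setTI; exact: measurable_funP.
have YZ : independent_RV Y Z.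
  move=> B1 B2 mB1 mB2.
  have := XYZ setT B1 B2 measurableT mB1 mB2.
  by rewrite preimage_setT setTI probability_setT mul1e.
pose p : {nonneg R} := NngNum (fine_ge0 (measure_ge0 P (X @^-1` A))).
have pE : P (X @^-1` A) = p%:num%:E by rewrite /= fineK// fin_num_measure.
pose G : set (set (V2 * V3)) :=
  [set C | exists2 B1, measurable B1 & exists2 B2, measurable B2 & B1 `*` B2 = C].
rewrite setIC pE.
(* The finite measures compared are the law of [(Y, Z)] restricted to the event [X in A], and the
   law of [(Y, Z)] scaled by the probability [p] of that event. *)
have := @measure_unique _ R (V2 * V3)%type G (fun=> setT) _ _ _ _
  (pushforward (mrestr P mXA) (RV_pair Y Z))
  (mscale p (distribution P (RV_pair Y Z))).
apply => //.
- exact: measurable_prod_measurableType.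
- move=> _ _ [B1 mB1 [B2 mB2 <-]] [D1 mD1 [D2 mD2 <-]].
  exists (B1 `&` D1); first exact: measurableI.
  by exists (B2 `&` D2); [exact: measurableI|rewrite setXI].
- by move=> _; exists setT => //; exists setT => //; rewrite setXTT.
- by rewrite bigcup_const.
- move=> _ [B1 mB1 [B2 mB2 <-]].
  change (P (Y @^-1` B1 `&` Z @^-1` B2 `&` X @^-1` A) =
    p%:num%:E * P (Y @^-1` B1 `&` Z @^-1` B2)).
  by rewrite YZ// setIC setIA XYZ// muleA -pE.
- by move=> _; change (P (setT `&` X @^-1` A) < +oo); rewrite setTI pE ltry.
Qed.

Lemma independent_RV_comp d1 d2 d3 (V1 : measurableType d1)
    (V2 : measurableType d2) (V3 : measurableType d3) (X : {RV P >-> V1})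
    (Y : {RV P >-> V2}) (Z : {RV P >-> V3}) (g : V2 -> V3) :
  measurable_fun setT g -> (forall t, Z t = g (Y t)) ->
  independent_RV X Y -> independent_RV X Z.
Proof.
move=> mg Zg XY A B mA mB.
have -> : Z @^-1` B = Y @^-1` (g @^-1` B).
  by apply/seteqP; split => t; rewrite /preimage/= Zg.
by apply: XY => //; rewrite -[X in measurable X]setTI; exact: mg.
Qed.

End densities.

Arguments has_density {d T R} P {d' V} mu X f.
Arguments independent_RV {d T R} P {d1 d2 V1 V2} X Y.

Lemma integral_indicM d (T : measurableType d) (R : realType)
    (mu : {measure set T -> \bar R}) (A : set T) (f : T -> R) :
  (\int[mu]_(x in A) (f x)%:E = \int[mu]_x (f x * \1_A x)%:E)%E.
Proof.
rewrite integral_mkcond; apply: eq_integral => x _; rewrite patchE indicE.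
by case: (x \in A); rewrite ?mulr1 ?mulr0.
Qed.

(** * Joint and marginal densities of a linear channel *)

Section joint_density.
Context d (T : measurableType d) (R : realType) (P : probability T R).
Context (k m : nat).
Local Open Scope ereal_scope.

Let lam := sfprod_measure (lebesgue_cV R k) (lebesgue_cV R m).

Lemma measurable_fst_cV : measurable_fun setT (@fst 'cV[R]_k 'cV[R]_m).
Proof. exact: measurable_fst. Qed.

Lemma measurable_snd_cV : measurable_fun setT (@snd 'cV[R]_k 'cV[R]_m).
Proof. exact: measurable_snd. Qed.

(** The pair [(U, V)] is the image of [(U, W)] under the shear [h]. For fixed [u], [h] merely
    translates [w] by [A u], so Tonelli and translation invariance replace a Jacobian equal to 1. *)
Lemma has_density_shear (A : 'M[R]_(m, k)) (U : {RV P >-> 'cV[R]_k})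
    (W V : {RV P >-> 'cV[R]_m}) (f : 'cV[R]_k -> R) (g : 'cV[R]_m -> R) :
  has_density P (lebesgue_cV R k) U f -> has_density P (lebesgue_cV R m) W g ->
  independent_RV P U W -> (forall t, V t = A *m U t + W t)%R ->
  has_density P lam (RV_pair U V) (fun z => f z.1 * g (z.2 - A *m z.1))%R.
Proof.
move=> Uf Wg UW VE; have [mf f0 _] := Uf; have [mg g0 gE] := Wg.
have mAk : measurable_fun setT (fun z : 'cV[R]_k * 'cV[R]_m => (A *m z.1)%R).
  by apply: measurable_mulmx => //; exact: measurable_fst_cV.
have mfg : measurable_fun setT
    (fun z : 'cV[R]_k * 'cV[R]_m => (f z.1 * g (z.2 - A *m z.1))%R).
  apply: measurable_funM; first exact: (measurableT_comp mf measurable_fst_cV).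
  apply: (measurableT_comp mg); apply: measurable_addmx.
    exact: measurable_snd_cV.
  exact: measurable_oppmx.
split => //; first by move=> z; rewrite mulr_ge0.
move=> C mC.
pose h (z : 'cV[R]_k * 'cV[R]_m) := (z.1, A *m z.1 + z.2)%R.
have mh : measurable_fun setT h.
  apply/measurable_fun_pairP; split; first exact: measurable_fst_cV.
  by apply: measurable_addmx => //; exact: measurable_snd_cV.
have mhC : measurable (h @^-1` C).
  by rewrite -[X in measurable X]setTI; exact: mh.
have -> : distribution P (RV_pair U V) C =
    distribution P (RV_pair U W) (h @^-1` C).
  change (P (RV_pair U V @^-1` C) = P ((h \o RV_pair U W) @^-1` C)).
  congr (P (_ @^-1` C)); apply/funext => t.
  by rewrite /RV_pair /h /= -VE.
rewrite distribution_independent_pair//.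
rewrite [LHS](ge0_integral_has_density Uf); last 2 first.
- exact: measurable_fun_xsection.
- by move=> x; exact: measure_ge0.
rewrite integral_indicM.
have mfgC : measurable_fun setT (fun z : 'cV[R]_k * 'cV[R]_m =>
    (f z.1 * g (z.2 - A *m z.1) * \1_C z)%:E).
  by apply/measurable_EFinP; apply: measurable_funM => //; exact: measurable_indic.
have fg0 z : (0 <= f z.1 * g (z.2 - A *m z.1) * \1_C z)%R.
  by rewrite !mulr_ge0.
rewrite [RHS](fubini_tonelli1 (fun z : 'cV[R]_k * 'cV[R]_m =>
    (f z.1 * g (z.2 - A *m z.1) * \1_C z)%:E))//.
apply: eq_integral => u _.
rewrite /= [X in X * _](gE _ (measurable_xsection u mhC)) integral_indicM.
have mgC : measurable_fun setT (fun w : 'cV[R]_m =>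
    (g (w - A *m u) * \1_C (u, w))%:E).
  apply/measurable_EFinP; apply: measurable_funM.
    by apply: (measurableT_comp mg); exact: measurable_addmx.
  exact: (measurableT_comp (measurable_indic mC)).
have gC0 (w : 'cV[R]_m) : (0 <= g (w - A *m u) * \1_C (u, w))%R.
  by rewrite mulr_ge0.
transitivity ((f u)%:E * \int[lebesgue_cV R m]_w (g (w - A *m u) * \1_C (u, w))%:E).
  rewrite muleC; congr (_ * _).
  (* With [w + A u] in place of [w], the indicator of [C] becomes that of the section at [u] of the
     preimage of [C] under [h]. *)
  rewrite -[RHS](@ge0_integral_lebesgue_cV_translation _ _ _ (A *m u))//.
  apply: eq_integral => w _; rewrite addrK; congr (_ * _)%:E.
  by rewrite !indicE mem_xsection /h/=; rewrite addrC.
rewrite -ge0_integralZl//; last 2 first.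
- by move=> w _; rewrite lee_fin.
- by rewrite lee_fin.
by apply: eq_integral => w _; rewrite -EFinM mulrA.
Qed.

Lemma has_density_snd (U : {RV P >-> 'cV[R]_k}) (V : {RV P >-> 'cV[R]_m})
    (f : 'cV[R]_k * 'cV[R]_m -> R) (g : 'cV[R]_m -> R) :
  has_density P lam (RV_pair U V) f ->
  measurable_fun setT g ->
  (forall y, \int[lebesgue_cV R k]_x (f (x, y))%:E = (g y)%:E) ->
  has_density P (lebesgue_cV R m) V g.
Proof.
move=> [mf f0 fE] mg fg; split => //.
  move=> y; rewrite -lee_fin -fg; apply: integral_ge0 => x _.
  by rewrite lee_fin.
move=> B mB.
have -> : distribution P V B = distribution P (RV_pair U V) (setT `*` B).
  by congr (P _); apply/seteqP; split => t; rewrite /preimage/=; [|case].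
rewrite fE; last exact: measurableX.
rewrite integral_indicM [RHS]integral_indicM.
rewrite (fubini_tonelli2 (fun z : 'cV[R]_k * 'cV[R]_m =>
   (f z * \1_(setT `*` B) z)%:E)); last 2 first.
- apply/measurable_EFinP; apply: measurable_funM => //.
  by apply: measurable_indic; exact: measurableX.
- by move=> z; rewrite lee_fin mulr_ge0.
apply: eq_integral => y _; rewrite /fubini_G EFinM -fg muleC.
rewrite -ge0_integralZl//; last 2 first.
- apply/measurable_EFinP; apply: measurableT_comp => //.
- by move=> x _; rewrite lee_fin.
apply: eq_integral => x _; rewrite -EFinM mulrC; congr (_ * _)%:E.
by rewrite !indicE in_setX in_setT.
Qed.

End joint_density.

(** * Entropies of Gaussian vectors *)

Section has_integral.
Context d (T : measurableType d) (R : realType).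
Variable mu : {measure set T -> \bar R}.
Implicit Types (f g : T -> R) (a c : R).

(** Logarithms of densities change sign, so additivity needs integrability; keeping it together with
    the value lets sums be integrated term by term. *)
Definition has_integral f a : Prop :=
  mu.-integrable setT (EFin \o f) /\ (\int[mu]_x (f x)%:E = a%:E)%E.

Lemma has_integral_ge0 f a : measurable_fun setT f -> (forall x, 0 <= f x) ->
  (\int[mu]_x (f x)%:E = a%:E)%E -> has_integral f a.
Proof.
move=> mf f0 fa; split => //; apply/integrableP; split.
  exact/measurable_EFinP.
under eq_integral do rewrite /= ger0_norm//.
by rewrite fa ltry.
Qed.

Lemma has_integralD f g a c : has_integral f a -> has_integral g c ->
  has_integral (fun x => f x + g x) (a + c).
Proof.
move=> [fi fa] [gi gc]; split.
  rewrite (_ : _ \o _ = (EFin \o f) \+ (EFin \o g))%E//.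
  exact: integrableD.
under eq_integral do rewrite EFinD.
by rewrite (@integralD _ _ _ mu setT measurableT (EFin \o f) (EFin \o g))// EFinD -fa -gc.
Qed.

Lemma has_integralZ f a c : has_integral f a ->
  has_integral (fun x => f x * c) (a * c).
Proof.
move=> [fi fa]; split.
  rewrite (_ : _ \o _ = (fun x => (EFin \o f) x * c%:E))%E//.
  exact: integrableZr.
under eq_integral do rewrite EFinM.
by rewrite integralZr// fa.
Qed.

End has_integral.

Section gaussian_entropy.
Context d (T : measurableType d) (R : realType) (P : probability T R) (b : R).

(** The inverse is expressed through [expR] and [ln]. Squaring makes the argument of [ln] positive
    whatever the sign of [f x], and at [f x = 0] both sides are 0 since [0^-1 = 0]. *)
Lemma measurable_funV d' (V : measurableType d') (f : V -> R) :
  measurable_fun setT f -> measurable_fun setT (fun x => (f x)^-1).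
Proof.
move=> mf; have -> : (fun x => (f x)^-1) = fun x => f x * expR (- ln (f x ^+ 2)).
  apply/funext => x; have [->|fx0] := eqVneq (f x) 0; first by rewrite invr0 mul0r.
  by rewrite expRN lnK ?posrE ?exprn_even_gt0// expr2 invfM mulVKf.
apply: measurable_funM => //; do 2 apply: measurableT_comp => //.
by apply: measurableT_comp; [exact: measurable_ln|exact: measurable_funX].
Qed.

Lemma measurable_logb d' (V : measurableType d') (f : V -> R) :
  measurable_fun setT f -> measurable_fun setT (fun x => logb b (f x)).
Proof.
move=> mf; apply: measurable_funM => //.
by apply: measurableT_comp => //; exact: measurable_ln.
Qed.

Lemma diff_entropy_mvnormal n (X : {RV P >-> 'cV[R]_n}) m S : posdef S ->
  has_density P (lebesgue_cV R n) X (mvnormal_pdf m S) ->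
  diff_entropy b X =
  ((n%:R / 2 - ln_peak S) / ln b)%:E.
Proof.
move=> Spd XS; set c := ln_peak S; have [mS S0 _] := XS.
have mD := measurable_density XS.
rewrite /diff_entropy.
rewrite (ae_eq_integral (fun x => (mvnormal_pdf m S x * c / ln b +
    mvnormal_pdf m S x * quad (invmx S) (x - m) * - (2 * ln b)^-1)%:E))//.
(* The factors [1] and [n%:R] are the total mass and the mean of the quadratic form. *)
- rewrite (_ : (_ - _) / _ = - (1 * c / ln b + n%:R * - (2 * ln b)^-1)); last first.
    by rewrite invfM; ring.
  rewrite EFinN; congr (- _)%E.
  under eq_integral do rewrite -[(_ * c / _)%R]mulrA.
  rewrite -[(1 * c / _)%R]mulrA.
  apply: (has_integralD _ _).2; apply: has_integralZ; apply: has_integral_ge0 => //.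
  + exact: integral_mvnormal_pdf.
  + apply: measurable_funM => //.
    by apply: measurable_quad; exact: measurable_addmx.
  + by move=> x; rewrite mulr_ge0// quad_ge0//; exact: posdef_inv.
  + exact: integral_mvnormal_pdf_quad.
- by apply/measurable_EFinP; apply: measurable_funM => //; exact: measurable_logb.
- apply/measurable_EFinP; apply: measurable_funD.
    by apply: measurable_funM => //; apply: measurable_funM.
  apply: measurable_funM => //; apply: measurable_funM => //.
  by apply: measurable_quad; exact: measurable_addmx.
- apply: filterS (density_ae_eq XS) => x -> _.
  rewrite /logb ln_mvnormal_pdf// -/c; congr EFin.
  by rewrite invfM; ring.
Qed.

End gaussian_entropy.

(** * The channel [V = A U + W] with Gaussian input and noise *)

Section gaussian_channel.
Context d (T : measurableType d) (R : realType) (P : probability T R) (b : R).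
Context (k m : nat) (A : 'M[R]_(m, k)) (SU : 'M[R]_k) (SW : 'M[R]_m).
Variables (U : {RV P >-> 'cV[R]_k}) (W V : {RV P >-> 'cV[R]_m}).
Hypotheses (SUpd : posdef SU) (SWpd : posdef SW).
Hypothesis Ug : has_density P (lebesgue_cV R k) U (mvnormal_pdf 0 SU).
Hypothesis Wg : has_density P (lebesgue_cV R m) W (mvnormal_pdf 0 SW).
Hypothesis UW : independent_RV P U W.
Hypothesis VE : forall t, V t = A *m U t + W t.

Let SV := SW + A *m SU *m A^T.
Let lam := sfprod_measure (lebesgue_cV R k) (lebesgue_cV R m).

Let SVpd : posdef SV. Proof. exact: posdef_add_congr. Qed.

Let f (z : 'cV[R]_k * 'cV[R]_m) : R :=
  mvnormal_pdf 0 SU z.1 * mvnormal_pdf (A *m z.1) SW z.2.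

Let mA : measurable_fun setT (fun z : 'cV[R]_k * 'cV[R]_m => A *m z.1).
Proof. by apply: measurable_mulmx => //; exact: measurable_fst_cV. Qed.

Let mf : measurable_fun setT f.
Proof.
by apply: measurable_funM; apply: measurable_mvnormal_pdf.
Qed.

Let f0 z : 0 <= f z. Proof. by rewrite mulr_ge0 ?mvnormal_pdf_ge0. Qed.

Let UVg : has_density P lam (RV_pair U V) f.
Proof.
have := has_density_shear Ug Wg UW VE.
congr has_density; apply/funext => z.
by rewrite /f !mvnormal_pdfE !subr0.
Qed.

(** Serves twice: for the output of the channel, and for an effective noise that is itself the
    output of a channel with input [Rnd] and noise [NE]. *)
Lemma mvnormal_channel_output :
  has_density P (lebesgue_cV R m) V (mvnormal_pdf 0 SV).
Proof.
apply: (has_density_snd UVg); first exact: measurable_mvnormal_pdf.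
by move=> y; exact: mvnormal_pdf_conv.
Qed.

Let mq n (S : 'M[R]_n) (h : 'cV[R]_k * 'cV[R]_m -> 'cV[R]_n) :
  measurable_fun setT h -> measurable_fun setT (fun z => f z * quad S (h z)).
Proof. by move=> mh; apply: measurable_funM => //; exact: measurable_quad. Qed.

Let q0 n (S : 'M[R]_n) (h : 'cV[R]_k * 'cV[R]_m -> 'cV[R]_n) z :
  posdef S -> 0 <= f z * quad (invmx S) (h z).
Proof. by move=> Spd; rewrite mulr_ge0// quad_ge0//; exact: posdef_inv. Qed.

Let int_f : has_integral lam f 1.
Proof.
apply: has_integral_ge0 => //.
rewrite [LHS](fubini_tonelli1 (EFin \o f))//; last exact/measurable_EFinP.
rewrite -[RHS](integral_mvnormal_pdf 0 SUpd); apply: eq_integral => x _.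
rewrite -[RHS]mule1 -(integral_mvnormal_pdf (A *m x) SWpd) -ge0_integralZl//.
- by apply/measurable_EFinP; exact: measurable_mvnormal_pdf.
- by move=> y _; rewrite lee_fin mvnormal_pdf_ge0.
- by rewrite lee_fin mvnormal_pdf_ge0.
Qed.

Let int_qU : has_integral lam (fun z => f z * quad (invmx SU) z.1) k%:R.
Proof.
apply: has_integral_ge0.
- by apply: mq; exact: measurable_fst_cV.
- by move=> z; exact: q0.
rewrite [LHS](fubini_tonelli1 (EFin \o (fun z => f z * quad (invmx SU) z.1)))//; last 2 first.
- by apply/measurable_EFinP; apply: mq; exact: measurable_fst_cV.
- by move=> z; rewrite lee_fin; exact: q0.
rewrite -(integral_mvnormal_pdf_quad 0 SUpd); apply: eq_integral => x _.
rewrite -[RHS]mule1 -(integral_mvnormal_pdf (A *m x) SWpd) -ge0_integralZl//.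
- by apply: eq_integral => y _; rewrite /= -EFinM /f subr0; congr EFin; ring.
- by apply/measurable_EFinP; exact: measurable_mvnormal_pdf.
- by move=> y _; rewrite lee_fin mvnormal_pdf_ge0.
- rewrite lee_fin mulr_ge0 ?mvnormal_pdf_ge0// quad_ge0//; exact: posdef_inv.
Qed.

(** For every [x], the inner integral over [y] is the moment [m] of a Gaussian centered at [A x]. *)
Let int_qW :
  has_integral lam (fun z => f z * quad (invmx SW) (z.2 - A *m z.1)) m%:R.
Proof.
have mh : measurable_fun setT (fun z : 'cV[R]_k * 'cV[R]_m => z.2 - A *m z.1).
  apply: measurable_addmx; first exact: measurable_snd_cV.
  exact: measurable_oppmx.
apply: has_integral_ge0.
- exact: mq.
- by move=> z; exact: (q0 (fun z => z.2 - A *m z.1)).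
rewrite [LHS](fubini_tonelli1 (EFin \o (fun z => f z * quad (invmx SW) (z.2 - A *m z.1))))//; last 2 first.
- by apply/measurable_EFinP; exact: mq.
- by move=> z; rewrite lee_fin; exact: (q0 (fun z => z.2 - A *m z.1)).
transitivity (\int[lebesgue_cV R k]_x ((mvnormal_pdf 0 SU x)%:E * m%:R%:E))%E.
  apply: eq_integral => x _.
  rewrite -(integral_mvnormal_pdf_quad (A *m x) SWpd) -ge0_integralZl//.
  - by apply: eq_integral => y _; rewrite -EFinM mulrA.
  - apply/measurable_EFinP; apply: measurable_funM; first exact: measurable_mvnormal_pdf.
    by apply: measurable_quad; exact: measurable_addmx.
  - move=> y _; rewrite lee_fin mulr_ge0 ?mvnormal_pdf_ge0// quad_ge0//.
    exact: posdef_inv.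
  - by rewrite lee_fin mvnormal_pdf_ge0.
rewrite ge0_integralZr//; last 2 first.
- by apply/measurable_EFinP; exact: measurable_mvnormal_pdf.
- by move=> x _; rewrite lee_fin mvnormal_pdf_ge0.
by rewrite integral_mvnormal_pdf// mul1e.
Qed.

(** Here Tonelli integrates [x] first: [mvnormal_pdf_conv] turns the joint density into that of [V],
    whose moment is known. *)
Let int_qV : has_integral lam (fun z => f z * quad (invmx SV) z.2) m%:R.
Proof.
apply: has_integral_ge0.
- by apply: mq; exact: measurable_snd_cV.
- by move=> z; exact: q0.
rewrite [LHS](fubini_tonelli2 (EFin \o (fun z => f z * quad (invmx SV) z.2)))//; last 2 first.
- by apply/measurable_EFinP; apply: mq; exact: measurable_snd_cV.
- by move=> z; rewrite lee_fin; exact: q0.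
rewrite -(integral_mvnormal_pdf_quad 0 SVpd); apply: eq_integral => y _.
rewrite EFinM -(mvnormal_pdf_conv A y SWpd SUpd) -ge0_integralZr//.
- by apply: eq_integral => x _; rewrite subr0.
- apply/measurable_EFinP; apply: measurable_funM; apply: measurable_mvnormal_pdf => //.
  exact: measurable_mulmx.
- by move=> x _; rewrite lee_fin mulr_ge0 ?mvnormal_pdf_ge0.
- rewrite lee_fin quad_ge0//; exact: posdef_inv.
Qed.

(** The cylinder over a null set is null even if its other side has infinite measure, as
    [+oo * 0 = 0]. It carries the almost everywhere formula for the density of [V] to pairs. *)
Let ae_snd (Q : 'cV[R]_m -> Prop) :
  {ae lebesgue_cV R m, forall y, Q y} -> {ae lam, forall z, Q z.2}.
Proof.
move=> [N [mN N0 QN]]; exists (setT `*` N); split.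
- exact: measurableX.
- by rewrite /lam /sfprod_measure product_measure1E// N0 mule0.
- by move=> z Qz; split => //; exact: QN.
Qed.

Local Notation c := ln_peak.

Lemma cond_diff_entropy_mvnormal :
  cond_diff_entropy b U V = ((k%:R / 2 - c SU - c SW + c SV) / ln b)%:E.
Proof.
have Vg := mvnormal_channel_output.
rewrite /cond_diff_entropy -/lam.
have mD := measurable_density UVg; have mDV := measurable_density Vg.
(* The expansion of [f * logb b (f_U * f_W / f_V)]. The moments [m] of [W] and [V] occur in [a] with
   opposite signs and cancel. *)
pose g z := f z * ((c SU + c SW - c SV) / ln b) +
  f z * quad (invmx SU) z.1 * - (2 * ln b)^-1 +
  f z * quad (invmx SW) (z.2 - A *m z.1) * - (2 * ln b)^-1 +
  f z * quad (invmx SV) z.2 * (2 * ln b)^-1.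
pose a : R := 1 * ((c SU + c SW - c SV) / ln b) +
  k%:R * - (2 * ln b)^-1 + m%:R * - (2 * ln b)^-1 + m%:R * (2 * ln b)^-1.
have ga : has_integral lam g a.
  apply: has_integralD; last exact: has_integralZ.
  apply: has_integralD; last exact: has_integralZ.
  apply: has_integralD; last exact: has_integralZ.
  exact: has_integralZ.
rewrite (ae_eq_integral (EFin \o g))//.
- rewrite ga.2 -EFinN; congr EFin; rewrite /a invfM; ring.
- apply/measurable_EFinP; apply: measurable_funM => //; apply: measurable_logb.
  apply: measurable_funM => //; apply: measurable_funV.
  exact: (measurableT_comp mDV (@measurable_snd_cV R k m)).
- exact: measurable_int ga.1.
- have := ae_snd (density_ae_eq Vg).
  apply: filterS2 (density_ae_eq UVg) => z -> -> _.
  congr EFin; rewrite /g /logb {2}/f.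
  have lnE (x y w : R) : 0 < x -> 0 < y -> 0 < w ->
      ln (x * y / w) = ln x + ln y - ln w.
    move=> x0 y0 w0.
    by rewrite lnM ?posrE ?mulr_gt0 ?invr_gt0// lnM// lnV.
  rewrite lnE ?mvnormal_pdf_gt0//.
  rewrite !ln_mvnormal_pdf// !subr0 -/SV invfM.
  by ring.
Qed.

End gaussian_channel.

(** * Reduction to the channel [YE = A M + Z] and comparison of determinants *)

Theorem lemma3p11 (R : realType) (b : R) (k n mE : nat)
    (PM PR gamma sigma : R)
    (Q1 : 'M[R]_(n, k)) (Q2 : 'M[R]_(n, n - k)) (HE : 'M[R]_(mE, n))
    (d : measure_display) (T : measurableType d) (P : probability T R)
    (M : {RV P >-> 'cV[R]_k}) (Rnd : {RV P >-> 'cV[R]_(n - k)})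
    (NE : {RV P >-> 'cV[R]_mE})
    (S : {RV P >-> 'cV[R]_(k + (n - k))}) (X : {RV P >-> 'cV[R]_n})
    (YE : {RV P >-> 'cV[R]_mE}) :
  1 < b ->
  (1 <= k)%N -> (k < n)%N -> (1 <= mE)%N ->
  0 < PM -> 0 < PR -> 0 < gamma -> 0 < sigma ->
  let QK := row_mx Q1 Q2 in
  orthogonal_mx QK ->
  mvnormal M 0 (PM%:M) ->
  mvnormal Rnd 0 (PR%:M) ->
  mvnormal NE 0 ((sigma ^+ 2)%:M) ->
  mutually_independent3 M Rnd NE ->
  (forall t, S t = (Num.sqrt gamma)^-1 *: col_mx (M t) (Rnd t)) ->
  (forall t, X t = QK *m S t) ->
  (forall t, YE t = HE *m X t + NE t) ->
  let Heff := HE *m Q1 in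
  let SigmaRN :=
    (sigma ^+ 2)%:M + (PR / gamma) *: (HE *m Q2 *m Q2^T *m HE^T) in
  (cond_diff_entropy b M YE >=
   diff_entropy b M -
   (1 / 2 * logb b
      (\det (1%:M + (PM / gamma) *: (Heff^T *m invmx SigmaRN *m Heff))))%:E)%E.
Proof.
move=> b1 _ _ _ PM0 PR0 g0 s0 QK _ MN RN NN MRN SE XE YEE.
lazy zeta; set Heff := HE *m Q1; set SigmaRN := _ + (PR / gamma) *: _.
have mvn k' (Z : {RV P >-> 'cV[R]_k'}) C : mvnormal Z 0 C ->
    has_density P (lebesgue_cV R k') Z (mvnormal_pdf 0 C).
  move=> ZC; split => //; first exact: measurable_mvnormal_pdf.
  by move=> x; exact: mvnormal_pdf_ge0.
have PMpd : posdef (PM%:M : 'M[R]_k) by exact: posdef_scalar.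
have PRpd : posdef (PR%:M : 'M[R]_(n - k)) by exact: posdef_scalar.
have sgpd : posdef ((sigma ^+ 2)%:M : 'M[R]_mE).
  by apply: posdef_scalar; rewrite exprn_gt0.
(* The normalization of [S] is absorbed into [A] and [B]; occurring twice in each covariance, it
   yields the [gamma^-1] of the statement. *)
pose A := (Num.sqrt gamma)^-1 *: Heff.
pose B := (Num.sqrt gamma)^-1 *: (HE *m Q2).
have gE : (Num.sqrt gamma)^-1 * (Num.sqrt gamma)^-1 = gamma^-1.
  by rewrite -invfM -expr2 sqr_sqrtr// ltW.
have SigmaE : SigmaRN = (sigma ^+ 2)%:M + B *m PR%:M *m B^T.
  rewrite /SigmaRN /B mul_mx_scalar scalerA linearZ/= -scalemxAl -scalemxAr.
  by rewrite scalerA -mulrA gE trmx_mul mulmxA.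
have mZ : measurable_fun setT (fun t => B *m Rnd t + NE t).
  by apply: measurable_addmx => //; exact: measurable_mulmx.
(* The effective noise seen by [M]: both the random part of the input and the channel noise. *)
pose Z : {RV P >-> 'cV[R]_mE} := HB.pack (fun t => B *m Rnd t + NE t)
  (isMeasurableFun.Build _ _ _ _ _ mZ).
have RNi : independent_RV P Rnd NE.
  move=> A1 A2 mA1 mA2; have := MRN setT A1 A2 measurableT mA1 mA2.
  by rewrite preimage_setT setTI probability_setT mul1e.
have ZN : has_density P (lebesgue_cV R mE) Z (mvnormal_pdf 0 SigmaRN).
  rewrite SigmaE.
  exact: (mvnormal_channel_output PRpd sgpd (mvn _ _ _ RN) (mvn _ _ _ NN) RNi).
have MZ : independent_RV P M Z.
  apply: (independent_RV_comp (g := fun z => B *m z.1 + z.2) _ _ (independent_RV_pair MRN)) => //.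
  apply: measurable_addmx; last exact: measurable_snd_cV.
  by apply: measurable_mulmx => //; exact: measurable_fst_cV.
have YZ t : YE t = A *m M t + Z t.
  rewrite YEE XE SE /QK /A /B /= -scalemxAr mul_row_col -scalemxAr mulmxDr scalerDr.
  by rewrite -!scalemxAl !mulmxA addrA.
have Spd : posdef SigmaRN by rewrite SigmaE; exact: posdef_add_congr.
rewrite (cond_diff_entropy_mvnormal _ PMpd Spd (mvn _ _ _ MN) ZN MZ YZ).
rewrite (diff_entropy_mvnormal _ PMpd (mvn _ _ _ MN)).
rewrite -EFinB lee_fin.
have detE : \det (SigmaRN + A *m PM%:M *m A^T) = \det SigmaRN *
    \det (1%:M + (PM / gamma) *: (Heff^T *m invmx SigmaRN *m Heff)).
  (* [det (PM I)] is multiplied into the last determinant, turning [PM^-1 I + A^T SigmaRN^-1 A] into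
     the matrix of the statement. *)
  rewrite det_add_congr ?posdef_unit// -mulrA -det_mulmx mulmxDr.
  rewrite mulmxV ?posdef_unit//; congr (_ * \det (_ + _)).
  rewrite mul_scalar_mx /A [(_ *: Heff)^T]linearZ/= -scalemxAr -!scalemxAl.
  by rewrite !scalerA gE.
set D := \det (1%:M + _) in detE *.
have dS := posdef_det_gt0 Spd.
have D0 : 0 < D.
  (* [D] is a quotient of two positive determinants. *)
  by rewrite -(pmulr_rgt0 _ dS) -detE posdef_det_gt0//; exact: posdef_add_congr.
have peakE : ln_peak (SigmaRN + A *m PM%:M *m A^T) = ln_peak SigmaRN - ln D / 2.
  rewrite /ln_peak detE mulrA.
  have c0 : 0 < (2 * pi : R) ^+ mE * \det SigmaRN.
    by rewrite mulr_gt0// exprn_gt0// mulr_gt0// pi_gt0.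
  rewrite sqrtrM ?ltW// lnM ?posrE ?sqrtr_gt0// opprD; congr (_ - _).
  have -> : ln D = ln (Num.sqrt D) * 2.
    by rewrite mulr_natr -lnXn ?sqrtr_gt0// sqr_sqrtr// ltW.
  by rewrite mulfK.
(* The terms [ln_peak SigmaRN] cancel, leaving exactly [h(M)] minus half the logarithm of [D]. *)
rewrite peakE /logb le_eqVlt; apply/orP; left; apply/eqP.
by ring.
Qed.
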